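(* Let $m\ge 1$, let $\{P_0,\dots,P_m\}$ be a symmetric Clifford system on $\mathbb{R}^{2l}$ with $l-m-1\ge 1$, let $F(x)=|x|^4-2\sum_{i=0}^m\langle P_ix,x\rangle^2$, and let $M_0=F^{-1}(0)\cap S^{2l-1}$, equipped with the metric $ds^2$ induced from $S^{2l-1}$. Let $J$ be the endomorphism of $TM_0$ given at $x\in M_0$ by $$J\eta_1=\eta_2,\qquad J\eta_2=-\eta_1,\qquad JX=P_0P_1X\ \text{ for } X\in E,$$ where $\eta_1=P_0P_1x$, $\eta_2=P_0P_1\xi(x)$, $\xi(x)=x-2\sum_{i=0}^m\langle P_ix,x\rangle P_ix$, and $E$ is the orthogonal complement of $\mathrm{Span}\{\eta_1,\eta_2\}$ in $T_xM_0$. Then $(M_0,J,ds^2)$ is an almost Hermitian manifold.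
   Context: A symmetric Clifford system on $\mathbb{R}^{2l}$ is a collection of real symmetric $2l\times 2l$ matrices $P_0,\dots,P_m$ with $P_iP_j+P_jP_i=2\delta_{ij}I_{2l}$. $S^{2l-1}$ is the unit sphere in $\mathbb{R}^{2l}$. The restriction $f=F|_{S^{2l-1}}$ has image $[-1,1]$; $M_0=f^{-1}(0)$ is a regular level set of $f$, hence a smooth hypersurface of $S^{2l-1}$, and $\xi(x)$ is a unit normal vector of $M_0$ in $S^{2l-1}$ at $x$. (It is called an isoparametric hypersurface of OT-FKM type, whose principal curvatures have multiplicities $(m_1,m_2,m_1,m_2)$ with $(m_1,m_2)=(m,l-m-1)$.) An almost complex structure on a manifold $M$ is a smooth endomorphism $J$ of $TM$ with $J^2=-I$. $(M,J,ds^2)$ is almost Hermitian if $J$ is an almost complex structure on $M$ and $ds^2$ is a Riemannian metric with $ds^2(JX,JY)=ds^2(X,Y)$ for all tangent vectors $X,Y$. The statement includes that $J$ is well defined, i.e. $\eta_1,\eta_2\in T_xM_0$ are linearly independent and $P_0P_1E\subset E$. *)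

(* Defs.v *)
From HB Require Import structures.
From mathcomp Require Import all_boot all_order all_algebra.
From mathcomp Require Import all_classical all_reals all_analysis.

Set Implicit Arguments.
Unset Strict Implicit.
Unset Printing Implicit Defensive.

Import Order.TTheory GRing.Theory Num.Theory.
Import numFieldNormedType.Exports.

Local Open Scope classical_set_scope.
Local Open Scope ring_scope.

(* The library norm `|x| on column vectors is the sup norm. It only provides the
   topology and the derivatives below; all metric notions go through [dot]. *)
Definition dot (R : realType) (n : nat) (u v : 'cV[R]_n) : R :=
  (u^T *m v) 0 0.

(* f is C^k on U; meant for open U. *)
Fixpoint Ck_on (R : realType) (V W : normedModType R) (k : nat) (U : set V)
    (f : V -> W) : Prop :=
  if k is k'.+1 then
    (forall x, U x -> differentiable f x) /\
    (forall v : V, Ck_on k' U ('D_v f))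
  else forall x, U x -> {for x, continuous f}.

Definition smooth_on (R : realType) (V W : normedModType R) (U : set V)
    (f : V -> W) : Prop := forall k, Ck_on k U f.

(* Smoothness on an arbitrary subset A: f has smooth local extensions. The
   values of f outside of A are irrelevant. *)
Definition smooth_on_subset (R : realType) (V W : normedModType R) (A : set V)
    (f : V -> W) : Prop :=
  forall x, A x -> exists (U : set V) (g : V -> W),
    [/\ open U, U x, smooth_on U g & forall y, U y -> A y -> g y = f y].

(* Embedded submanifold of codimension k, without boundary. *)
Definition embedded_submanifold (R : realType) (n k : nat)
    (M : set 'cV[R]_n) : Prop :=
  forall x, M x -> exists (U : set 'cV[R]_n) (g : 'cV[R]_n -> 'cV[R]_k),
    [/\ open U, U x, smooth_on U g,
        forall y, U y -> (M y <-> g y = 0) &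
        forall y, U y -> M y -> forall w, exists v, 'd g y v = w].

(* Velocities at x of smooth curves in M. *)
Definition tangent_space (R : realType) (n : nat) (M : set 'cV[R]_n)
    (x : 'cV[R]_n) : set 'cV[R]_n :=
  [set v | exists (I : set R^o) (c : R^o -> 'cV[R]_n),
    [/\ open I, I 0 & smooth_on I c] /\
    [/\ forall t, I t -> M (c t), c 0 = x & 'D_1 c 0 = v]].

Definition tangent_bundle (R : realType) (n : nat) (M : set 'cV[R]_n)
    : set ('cV[R]_n * 'cV[R]_n) :=
  [set p | M p.1 /\ tangent_space M p.1 p.2].

(* A tensor field on M is a function of the base point and of ambient vectors,
   of which only the values at tangent vectors of M matter. *)
Definition tangent_endomorphism (R : realType) (n : nat) (M : set 'cV[R]_n)
    (J : 'cV[R]_n -> 'cV[R]_n -> 'cV[R]_n) : Prop :=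
  forall x, M x ->
    (forall u, tangent_space M x u -> tangent_space M x (J x u)) /\
    (forall (a : R) u v, tangent_space M x u -> tangent_space M x v ->
       J x (a *: u + v) = a *: J x u + J x v).

Definition almost_complex_structure (R : realType) (n : nat)
    (M : set 'cV[R]_n) (J : 'cV[R]_n -> 'cV[R]_n -> 'cV[R]_n) : Prop :=
  [/\ tangent_endomorphism M J,
      smooth_on_subset (tangent_bundle M) (fun p => J p.1 p.2) &
      forall x u, M x -> tangent_space M x u -> J x (J x u) = - u].

Definition riemannian_metric (R : realType) (n : nat) (M : set 'cV[R]_n)
    (g : 'cV[R]_n -> 'cV[R]_n -> 'cV[R]_n -> R) : Prop :=
  (forall x, M x ->
    [/\ forall u v, tangent_space M x u -> tangent_space M x v ->
          g x u v = g x v u,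
        forall (a : R) u v w, tangent_space M x u -> tangent_space M x v ->
          tangent_space M x w -> g x (a *: u + v) w = a * g x u w + g x v w &
        forall u, tangent_space M x u -> u != 0 -> 0 < g x u u]) /\
  smooth_on_subset
    [set p : 'cV[R]_n * 'cV[R]_n * 'cV[R]_n | M p.1.1 /\
       tangent_space M p.1.1 p.1.2 /\ tangent_space M p.1.1 p.2]
    (fun p => g p.1.1 p.1.2 p.2 : R^o).

Definition almost_hermitian_manifold (R : realType) (n : nat)
    (M : set 'cV[R]_n) (J : 'cV[R]_n -> 'cV[R]_n -> 'cV[R]_n)
    (g : 'cV[R]_n -> 'cV[R]_n -> 'cV[R]_n -> R) : Prop :=
  [/\ exists k, embedded_submanifold k M,
      almost_complex_structure M J,
      riemannian_metric M g &
      forall x u v, M x -> tangent_space M x u -> tangent_space M x v ->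
        g x (J x u) (J x v) = g x u v].

(* The metric induced from the Euclidean one; on a submanifold of the unit
   sphere it is also the one induced from the round metric. *)
Definition induced_metric (R : realType) (n : nat) (x u v : 'cV[R]_n) : R :=
  dot u v.

Definition symmetric_clifford_system (R : realType) (n m : nat)
    (P : 'I_m.+1 -> 'M[R]_n) : Prop :=
  (forall i, (P i)^T = P i) /\
  (forall i j, P i *m P j + P j *m P i = (2 * (i == j)%:R)%:M).

Section FKM.
Variables (R : realType) (n m : nat) (P : 'I_m.+1 -> 'M[R]_n).
Implicit Types x X : 'cV[R]_n.

Definition unit_sphere : set 'cV[R]_n := [set x | dot x x = 1].

Definition FKM_polynomial x : R :=
  dot x x ^+ 2 - 2 * \sum_(i < m.+1) dot (P i *m x) x ^+ 2.

Definition FKM_M0 : set 'cV[R]_n :=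
  [set x | FKM_polynomial x = 0] `&` unit_sphere.

Definition FKM_xi x : 'cV[R]_n :=
  x - 2 *: \sum_(i < m.+1) dot (P i *m x) x *: (P i *m x).

(* [inord 1] is the index 1 only when 1 <= m. *)
Definition P0P1 : 'M[R]_n := P ord0 *m P (inord 1).

Definition FKM_eta1 x : 'cV[R]_n := P0P1 *m x.

Definition FKM_eta2 x : 'cV[R]_n := P0P1 *m FKM_xi x.

Definition FKM_E x : set 'cV[R]_n :=
  [set X | [/\ tangent_space FKM_M0 x X,
               dot X (FKM_eta1 x) = 0 & dot X (FKM_eta2 x) = 0]].

Definition FKM_J_spec (J : 'cV[R]_n -> 'cV[R]_n -> 'cV[R]_n) : Prop :=
  tangent_endomorphism FKM_M0 J /\
  forall x, FKM_M0 x ->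
    [/\ J x (FKM_eta1 x) = FKM_eta2 x,
        J x (FKM_eta2 x) = - FKM_eta1 x &
        forall X, FKM_E x X -> J x X = P0P1 *m X].

End FKM.

(* Main.v *)
Require Import Defs.
From HB Require Import structures.
From mathcomp Require Import all_boot all_order all_algebra.
From mathcomp Require Import all_classical all_reals all_analysis.
From mathcomp Require Import ring lra.

Set Implicit Arguments.
Unset Strict Implicit.
Unset Printing Implicit Defensive.

Import Order.TTheory GRing.Theory Num.Theory.
Import numFieldNormedType.Exports.

Local Open Scope classical_set_scope.
Local Open Scope ring_scope.

(** On M_0 one has grad F = 4 xi, so T_x M_0 is contained in the orthogonal
    complement of x and xi(x).  Conversely, for v in that complement put
    y = x + t v, N = |y|^2, q = sum_i <P_i y, y>^2 and Q = sum_i <P_i y, y> P_i.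
    The Clifford relations give Q^2 = q and express F(al y + be Q y) through
    al, be, N and q alone; solving for al, be (two square roots) and normalizing
    yields an explicit smooth curve in M_0 with velocity v, without the implicit
    function theorem.  The matrix A = P_0 P_1 is skew and orthogonal and
    <A x, xi(x)> = 0, so x, xi, A x, A xi are orthonormal and their span is
    A-invariant; hence so is its complement E, on which J = A. *)

(** * Closure properties of C^k maps *)

Section Smoothness.
Variable R : realType.
Implicit Types V W : normedModType R.

(** Differentiability depends only on the germ: the first-order expansion of [f] at [x] serves for
    [g] too, and [diff_unique] identifies its linear part with ['d g x]. *)
Lemma near_eq_differentiable V W (f g : V -> W) (x : V) :
  (\near x, f x = g x) -> differentiable f x -> differentiable g x.
Proof.
move=> fg df.
have [_ fE] := (diff_locallyxP x f).1 df.
have gE : g \o shift x = cst (g x) + 'd f x +o_ 0 id.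
  apply/eqaddoP => e e0.
  have /eqaddoP /(_ e e0) fE0 := funext fE.
  have := nbhs_singleton fg; rewrite /= => fgx.
  move: fg; rewrite (near_shift 0 x) subr0; apply: filterS2 fE0 => y /= + fgy.
  by rewrite !fctE /= -fgx -fgy.
apply/diff_locallyP; rewrite (diff_unique (diff_continuous df) gE).
by split; first exact: diff_continuous.
Qed.

(** The rules for ['D_v] hold only at points of [U], while [Ck_on] speaks of total functions; the
    closure lemmas bridge the gap by this one. Openness of [U] turns equality on [U] into equality
    of germs. *)
Lemma Ck_on_ext V W k (U : set V) (f g : V -> W) :
  open U -> (forall x, U x -> f x = g x) -> Ck_on k U f -> Ck_on k U g.
Proof.
move=> oU; elim: k f g => [|k IH] f g fg.
  move=> cf x Ux; have nfg : \near x, f x = g x.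
    by apply: filterS (open_nbhs_nbhs (conj oU Ux)).
  rewrite /prop_for /continuous_at -(fg x Ux); apply: cvg_trans (cf x Ux).
  by apply: near_eq_cvg; apply: filterS nfg => y ->.
move=> [df Df]; split=> [x Ux|v].
  apply: near_eq_differentiable (df x Ux).
  by apply: filterS (open_nbhs_nbhs (conj oU Ux)).
apply: IH (Df v) => x Ux; apply: near_eq_derive.
by apply: filterS (open_nbhs_nbhs (conj oU Ux)).
Qed.

Lemma Ck_on_cont V W k (U : set V) (f : V -> W) :
  Ck_on k U f -> forall x, U x -> {for x, continuous f}.
Proof.
by case: k => // k [df _] x /df; exact: differentiable_continuous.
Qed.

Lemma Ck_onS V W k (U : set V) (f : V -> W) : Ck_on k.+1 U f -> Ck_on k U f.
Proof.
elim: k f => [|k IH] f Cf; first exact: Ck_on_cont Cf.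
by case: Cf => df Df; split=> // v; exact: IH.
Qed.

Lemma Ck_on_cst V W k (U : set V) (w : W) : Ck_on k U (fun=> w).
Proof.
elim: k w => [|k IH] w; first by move=> x _; exact: cst_continuous.
split=> [x _|v]; first exact: differentiable_cst.
have -> : 'D_v (fun=> w) = (fun=> 0) :> (V -> W); last exact: IH.
by apply/funext => x; exact: derive_cst.
Qed.

Lemma Ck_on_id V k (U : set V) : Ck_on k U (@id V).
Proof.
case: k => [|k]; first by move=> x _; exact: cvg_id.
split=> [x _|v]; first exact: ex_diff.
have -> : 'D_v (@id V) = (fun=> v); last exact: Ck_on_cst.
by apply/funext => x; rewrite derive_id.
Qed.

(** ['D_v] commutes with a continuous linear map, so the induction keeps the same [L]. *)
Lemma Ck_on_comp_lin V W W' k (U : set V) (L : {linear W -> W'}) (f : V -> W) :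
  open U -> continuous L -> Ck_on k U f -> Ck_on k U (fun x => L (f x)).
Proof.
move=> oU cL; elim: k f => [|k IH] f.
  by move=> cf x Ux; apply: continuous_comp; [exact: cf|exact: cL].
move=> [df Df]; have dL y : differentiable L y by exact: linear_differentiable.
split=> [x Ux|v]; first exact: differentiable_comp (df x Ux) (dL _).
apply: Ck_on_ext (IH _ (Df v)) => //= x Ux.
rewrite !deriveE//; last by apply: df.
  by rewrite (diff_comp (df x Ux) (dL _)) /= diff_lin.
exact: differentiable_comp (df x Ux) (dL _).
Qed.

Lemma Ck_on_fst V W k (U : set (V * W)%type) :
  open U -> Ck_on k U (fun p : V * W => p.1).
Proof.
move=> oU; apply: (Ck_on_comp_lin (L := fst)) => //; last exact: Ck_on_id.
by move=> z; exact: cvg_fst.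
Qed.

Lemma Ck_on_snd V W k (U : set (V * W)%type) :
  open U -> Ck_on k U (fun p : V * W => p.2).
Proof.
move=> oU; apply: (Ck_on_comp_lin (L := snd)) => //; last exact: Ck_on_id.
by move=> z; exact: cvg_snd.
Qed.

Lemma Ck_onD V W k (U : set V) (f g : V -> W) :
  open U -> Ck_on k U f -> Ck_on k U g -> Ck_on k U (fun x => f x + g x).
Proof.
move=> oU; elim: k f g => [|k IH] f g.
  by move=> cf cg x Ux; apply: cvgD; [exact: cf|exact: cg].
move=> [df Df] [dg Dg]; split=> [x Ux|v].
  by apply: differentiableD; [exact: df|exact: dg].
apply: Ck_on_ext (IH _ _ (Df v) (Dg v)) => //= x Ux.
by rewrite -deriveD//; apply: diff_derivable; [exact: df|exact: dg].
Qed.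

(** By Leibniz the derivative involves [f] and [g] themselves, whose order [Ck_onS] lowers before
    the induction hypothesis applies. *)
Lemma Ck_onM V k (U : set V) (f g : V -> R^o) :
  open U -> Ck_on k U f -> Ck_on k U g ->
  Ck_on k U (fun x => f x * g x : R^o).
Proof.
move=> oU; elim: k f g => [|k IH] f g.
  by move=> cf cg x Ux; apply: cvgM; [exact: cf|exact: cg].
move=> Cf Cg; have [df Df] := Cf; have [dg Dg] := Cg; split=> [x Ux|v].
  by apply: (@differentiableM R V f g); [exact: df|exact: dg].
have := Ck_onD oU (IH _ _ (Ck_onS Cf) (Dg v)) (IH _ _ (Ck_onS Cg) (Df v)).
apply: Ck_on_ext => //= x Ux.
by symmetry; apply: (@deriveM R V f g); apply: diff_derivable;
  [exact: df|exact: dg].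
Qed.

Lemma Ck_on_sum V W n k (U : set V) (f : 'I_n -> V -> W) :
  open U -> (forall i, Ck_on k U (f i)) -> Ck_on k U (fun x => \sum_i f i x).
Proof.
move=> oU; elim: n f => [|n IH] f Cf.
  have -> : (fun x => \sum_i f i x) = fun=> 0; last exact: Ck_on_cst.
  by apply/funext => x; rewrite big_ord0.
have -> : (fun x => \sum_i f i x) =
    fun x => f ord0 x + \sum_i f (lift ord0 i) x.
  by apply/funext => x; rewrite big_ord_recl.
by apply: Ck_onD => //; exact: IH.
Qed.

Lemma Ck_on_coord V n k (U : set V) (f : V -> 'cV[R]_n) i :
  open U -> Ck_on k U f -> Ck_on k U (fun x => f x i 0 : R^o).
Proof.
move=> oU; have lin : linear (fun w : 'cV[R]_n => w i 0 : R^o).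
  by move=> a u w; rewrite !mxE.
pose L : {linear 'cV[R]_n -> R^o} :=
  HB.pack (fun w : 'cV[R]_n => w i 0 : R^o)
    (GRing.isLinear.Build _ _ _ _ _ lin).
by apply: (Ck_on_comp_lin (L := L)) => //; exact: coord_continuous.
Qed.

(** Each coordinate re-enters through the linear map [r *: delta_mx i 0], and the vector is the sum
    over the standard basis. *)
Lemma Ck_on_col V n k (U : set V) (f : V -> 'cV[R]_n) :
  open U -> (forall i, Ck_on k U (fun x => f x i 0 : R^o)) -> Ck_on k U f.
Proof.
move=> oU Cf.
have -> : f = fun x => \sum_i f x i 0 *: (delta_mx i 0 : 'cV[R]_n).
  apply/funext => x; rewrite [LHS]matrix_sum_delta; apply: eq_bigr => i _.
  by rewrite big_ord1.
apply: Ck_on_sum => // i.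
have lin : linear (fun r : R^o => r *: (delta_mx i 0 : 'cV[R]_n)).
  by move=> a u w; rewrite scalerDl scalerA.
pose L : {linear R^o -> 'cV[R]_n} :=
  HB.pack (fun r : R^o => r *: (delta_mx i 0 : 'cV[R]_n))
    (GRing.isLinear.Build _ _ _ _ _ lin).
by apply: (Ck_on_comp_lin (L := L)) => //; exact: scalel_continuous.
Qed.

Lemma Ck_on_scale V n k (U : set V) (a : V -> R^o) (f : V -> 'cV[R]_n) :
  open U -> Ck_on k U a -> Ck_on k U f -> Ck_on k U (fun x => a x *: f x).
Proof.
move=> oU Ca Cf; apply: Ck_on_col => // i.
have -> : (fun x => (a x *: f x) i 0) = (fun x => a x * f x i 0).
  by apply/funext => x; rewrite mxE.
by apply: Ck_onM => //; exact: Ck_on_coord.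
Qed.

Lemma Ck_on_mulmx V n p k (U : set V) (A : 'M[R]_(p, n)) (f : V -> 'cV[R]_n) :
  open U -> Ck_on k U f -> Ck_on k U (fun x => A *m f x).
Proof.
move=> oU Cf; apply: Ck_on_col => // i.
have -> : (fun x => (A *m f x) i 0) = (fun x => \sum_j A i j * f x j 0).
  by apply/funext => x; rewrite mxE.
apply: (@Ck_on_sum V R^o) => // j; apply: Ck_onM => //; first exact: Ck_on_cst.
exact: Ck_on_coord.
Qed.

Lemma Ck_on_dot V n k (U : set V) (f g : V -> 'cV[R]_n) :
  open U -> Ck_on k U f -> Ck_on k U g ->
  Ck_on k U (fun x => dot (f x) (g x) : R^o).
Proof.
move=> oU Cf Cg.
have -> : (fun x => dot (f x) (g x)) = (fun x => \sum_j f x j 0 * g x j 0).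
  by apply/funext => x; rewrite /dot mxE; apply: eq_bigr => j _; rewrite !mxE.
by apply: (@Ck_on_sum V R^o) => // j; apply: Ck_onM => //; exact: Ck_on_coord.
Qed.

(** The derivative is expressed by a cube of the function itself, which is the form that the
    induction in [Ck_on_rsqrt] needs. *)
Lemma is_derive_rsqrt (f : R^o -> R^o) (t df : R) :
  0 < f t -> is_derive (t : R^o) 1 f df ->
  is_derive (t : R^o) 1 (fun t => (Num.sqrt (f t))^-1 : R^o)
    (- 2^-1 * (Num.sqrt (f t))^-1 ^+ 3 * df).
Proof.
move=> ft0 dft.
have s0 : Num.sqrt (f t) != 0 by rewrite gt_eqF// sqrtr_gt0.
have dsf := is_derive1_comp (is_derive1_sqrt ft0) dft.
have := @is_deriveV R (Num.sqrt \o f) t _ 1 s0 dsf.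
move=> dV; apply: (is_derive_eq dV) => /=.
by rewrite -[_ *: _]/(_ * _); field.
Qed.

(** The derivative of f^(-1/2) is a polynomial in f^(-1/2) and f', so induction on [k] bootstraps
    the regularity. *)
Lemma Ck_on_rsqrt k (U : set R^o) (f : R^o -> R^o) :
  open U -> (forall t, U t -> 0 < f t) -> Ck_on k U f ->
  Ck_on k U (fun t => (Num.sqrt (f t))^-1 : R^o).
Proof.
move=> oU f0; elim: k => [|k IH].
  move=> cf t Ut; apply: cvgV; first by rewrite gt_eqF// sqrtr_gt0 f0.
  by apply: continuous_comp; [exact: cf|exact: sqrt_continuous].
move=> Cf; have [df Df] := Cf.
have dg t : U t -> is_derive (t : R^o) 1 (fun t => (Num.sqrt (f t))^-1 : R^o)
    (- 2^-1 * (Num.sqrt (f t))^-1 ^+ 3 * 'D_1 f t).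
  move=> Ut; apply: is_derive_rsqrt; first exact: f0.
  by apply: derivableP; apply: diff_derivable; exact: df.
have ddg t : U t -> differentiable (fun t => (Num.sqrt (f t))^-1 : R^o) t.
  by move=> Ut; apply/derivable1_diffP; case: (dg t Ut).
split=> // v.
have C := IH (Ck_onS Cf).
have := Ck_onM oU (Ck_on_cst k U (v * - 2^-1 : R^o))
  (Ck_onM oU (Ck_onM oU C (Ck_onM oU C C)) (Df 1)).
apply: Ck_on_ext => //= t Ut.
(* On [R^o] the derivative in direction [v] is [v] times the one in direction [1]. *)
rewrite (deriveE v (ddg t Ut)) -[v in RHS](mulr1 v).
rewrite [RHS](linearZ_LR _ v (1 : R^o)) -(deriveE (1 : R^o) (ddg t Ut)).
have [_ ->] := dg t Ut.
rewrite -[RHS]/(v * (- 2^-1 * (Num.sqrt (f t))^-1 ^+ 3 * 'D_1 f t)).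
by ring.
Qed.

End Smoothness.

(** * Euclidean inner product and derivatives *)

Section EuclideanDot.
Variables (R : realType) (n : nat).
Implicit Types (u v w : 'cV[R]_n) (A : 'M[R]_n).

Lemma dotE u v : dot u v = \sum_i u i 0 * v i 0.
Proof. by rewrite /dot mxE; apply: eq_bigr => i _; rewrite mxE. Qed.

Lemma dotC u v : dot u v = dot v u.
Proof. by rewrite !dotE; apply: eq_bigr => i _; rewrite mulrC. Qed.

Lemma dotDl u v w : dot (u + v) w = dot u w + dot v w.
Proof. by rewrite /dot linearD mulmxDl mxE. Qed.

Lemma dotZl a u v : dot (a *: u) v = a * dot u v.
Proof. by rewrite /dot linearZ -scalemxAl mxE. Qed.

Lemma dotNl u v : dot (- u) v = - dot u v.
Proof. by rewrite -scaleN1r dotZl mulN1r. Qed.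

Lemma dotDr u v w : dot w (u + v) = dot w u + dot w v.
Proof. by rewrite !(dotC w) dotDl. Qed.

Lemma dotZr a u v : dot u (a *: v) = a * dot u v.
Proof. by rewrite !(dotC u) dotZl. Qed.

Lemma dotNr u v : dot u (- v) = - dot u v.
Proof. by rewrite !(dotC u) dotNl. Qed.

Lemma dot0l u : dot 0 u = 0.
Proof. by rewrite -(scale0r 0) dotZl mul0r. Qed.

Definition dot_lin := (dotDl, dotDr, dotNl, dotNr, dotZl, dotZr).

Lemma dot_suml k (f : 'I_k -> 'cV[R]_n) v :
  dot (\sum_i f i) v = \sum_i dot (f i) v.
Proof.
by apply: (big_morph (fun u => dot u v)) => [u w|]; rewrite ?dotDl ?dot0l.
Qed.

Lemma dot_mull A u v : dot (A *m u) v = dot u (A^T *m v).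
Proof. by rewrite /dot trmx_mul mulmxA. Qed.

Lemma dot_ge0 u : 0 <= dot u u.
Proof. by rewrite dotE sumr_ge0// => i _; rewrite -expr2 sqr_ge0. Qed.

Lemma dot_gt0 u : u != 0 -> 0 < dot u u.
Proof.
move=> u0; rewrite lt_def dot_ge0 andbT; apply: contra u0; rewrite dotE.
rewrite psumr_eq0 => [/allP u0|i _]; last by rewrite -expr2 sqr_ge0.
apply/eqP/colP => i; have := u0 i (mem_index_enum i).
by rewrite /= mulf_eq0 orbb mxE => /eqP.
Qed.

End EuclideanDot.

Section Derivatives.
Variables (R : realType) (V : normedModType R).
Implicit Types (x v : V).

Lemma is_derive_coord n (f : V -> 'cV[R]_n) x v (df : 'cV[R]_n) i :
  is_derive x v f df -> is_derive x v (fun y => f y i 0 : R^o) (df i 0).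
Proof.
move=> [Df <-]; split; first exact: ((derivable_mxP _ _ _).1 Df i 0).
by rewrite (derive_mx Df) mxE.
Qed.

Lemma is_derive_col n (f : V -> 'cV[R]_n) x v (df : 'cV[R]_n) :
  (forall i, is_derive x v (fun y => f y i 0 : R^o) (df i 0)) ->
  is_derive x v f df.
Proof.
move=> Df; have Df' : derivable f x v.
  by apply/derivable_mxP => i j; rewrite ord1; case: (Df i).
split=> //; rewrite (derive_mx Df'); apply/colP => i; rewrite mxE.
by case: (Df i).
Qed.

Lemma is_derive_dot n (f g : V -> 'cV[R]_n) x v (df dg : 'cV[R]_n) :
  is_derive x v f df -> is_derive x v g dg ->
  is_derive x v (fun y => dot (f y) (g y) : R^o) (dot (f x) dg + dot df (g x)).
Proof.
move=> Df Dg.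
have -> : (fun y => dot (f y) (g y)) =
    \sum_i ((fun y => f y i 0) * (fun y => g y i 0)).
  by apply/funext => y; rewrite dotE fct_sumE.
pose D i := is_deriveM (is_derive_coord i Df) (is_derive_coord i Dg).
apply: (is_derive_eq (is_derive_sum D)).
rewrite !dotE -big_split; apply: eq_bigr => i _ /=.
by rewrite -![_ *: _]/(_ * _) [df i 0 * _]mulrC.
Qed.

Lemma is_derive_mulmx n p (A : 'M[R]_(p, n)) (f : V -> 'cV[R]_n) x v
    (df : 'cV[R]_n) :
  is_derive x v f df -> is_derive x v (fun y => A *m f y) (A *m df).
Proof.
move=> Df; apply: is_derive_col => i.
have -> : (fun y => (A *m f y) i 0) = \sum_j A i j *: (fun y => f y j 0 : R^o).
  by apply/funext => y; rewrite mxE fct_sumE.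
pose D j := is_deriveZ (A i j) (is_derive_coord j Df).
by apply: (is_derive_eq (is_derive_sum D)); rewrite mxE.
Qed.

Lemma is_derive_scale n (a : V -> R^o) (f : V -> 'cV[R]_n) x v (da : R)
    (df : 'cV[R]_n) :
  is_derive x v a da -> is_derive x v f df ->
  is_derive x v (fun y => a y *: f y) (a x *: df + da *: f x).
Proof.
move=> Da Df; apply: is_derive_col => i.
have -> : (fun y => (a y *: f y) i 0) = (a : V -> R) * (fun y => f y i 0).
  by apply/funext => y; rewrite mxE.
apply: (is_derive_eq (is_deriveM Da (is_derive_coord i Df))).
by rewrite !mxE -![_ *: _]/(_ * _) [da * _]mulrC.
Qed.

End Derivatives.

(** * Identities for Clifford systems *)

Section Clifford.
Variables (R : realType) (n m : nat) (P : 'I_m.+1 -> 'M[R]_n).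
Hypothesis hP : symmetric_clifford_system P.
Implicit Types (x y v : 'cV[R]_n).

Definition FKM_sqsum x : R := \sum_i dot (P i *m x) x ^+ 2.

(** A point of the linear span of the [P i], whose square is scalar by the Clifford relations. As
    the [P i] are symmetric, [FKM_Q x *m x] is a quarter of the gradient of [FKM_sqsum] at [x]. *)
Definition FKM_Q x : 'M[R]_n := \sum_i dot (P i *m x) x *: P i.

Lemma FKM_polynomialE x :
  FKM_polynomial P x = dot x x ^+ 2 - 2 * FKM_sqsum x.
Proof. by []. Qed.

Lemma FKM_xiE x : FKM_xi P x = x - 2 *: (FKM_Q x *m x).
Proof.
by rewrite /FKM_xi mulmx_suml; under [in RHS]eq_bigr do rewrite -scalemxAl.
Qed.

Lemma cliff_tr i : (P i)^T = P i. Proof. exact: hP.1. Qed.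

Lemma cliffC i j : i != j -> P i *m P j = - (P j *m P i).
Proof.
move=> /negPf ij; have := hP.2 i j; rewrite ij mulr0 raddf0.
by move/eqP; rewrite addr_eq0 => /eqP.
Qed.

Lemma cliff_sq i : P i *m P i = 1%:M.
Proof.
have := hP.2 i i; rewrite eqxx mulr1 -mulr2n -scaler_nat.
move=> /(congr1 (fun M => 2^-1 *: M)).
by rewrite scalerA scale_scalar_mx mulVf ?pnatr_eq0// scale1r.
Qed.

Lemma cliffK i x : P i *m (P i *m x) = x.
Proof. by rewrite mulmxA cliff_sq mul1mx. Qed.

Lemma FKM_Q_tr x : (FKM_Q x)^T = FKM_Q x.
Proof.
by rewrite linear_sum; apply: eq_bigr => i _; rewrite linearZ /= cliff_tr.
Qed.

Lemma mulmx_FKM_Q x (M : 'M[R]_n) :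
  M *m FKM_Q x = \sum_i dot (P i *m x) x *: (M *m P i).
Proof.
by rewrite mulmx_sumr; apply: eq_bigr => i _; rewrite scalemxAr.
Qed.

Lemma mul_FKM_Q_mx x k (M : 'M[R]_(n, k)) :
  FKM_Q x *m M = \sum_i dot (P i *m x) x *: (P i *m M).
Proof.
by rewrite mulmx_suml; apply: eq_bigr => i _; rewrite scalemxAl.
Qed.

(** Distributing the anticommutator with [P i] over the sum leaves only the term of index [i]. *)
Lemma FKM_Q_anticomm x i :
  FKM_Q x *m P i = (2 * dot (P i *m x) x)%:M - P i *m FKM_Q x.
Proof.
rewrite -[LHS](addrK (P i *m FKM_Q x)); congr (_ - _).
rewrite mulmx_FKM_Q mul_FKM_Q_mx -big_split /=.
under eq_bigr do rewrite -scalerDr hP.2 scale_scalar_mx.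
rewrite (bigD1 i)//= eqxx mulr1 big1 => [|j /negPf ->]; last first.
  by rewrite mulr0 mulr0 raddf0.
by rewrite addr0 mulrC.
Qed.

(** Doubling Q^2 makes the anticommutators of Q with each [P i] appear, and these are scalar. *)
Lemma FKM_Q_sq x : FKM_Q x *m FKM_Q x = (FKM_sqsum x)%:M.
Proof.
have : FKM_Q x *m FKM_Q x + FKM_Q x *m FKM_Q x = (2 * FKM_sqsum x)%:M.
  rewrite {1}mulmx_FKM_Q mul_FKM_Q_mx -big_split /=.
  rewrite mulr_sumr raddf_sum; apply: eq_bigr => i _ /=.
  rewrite FKM_Q_anticomm -scalerDr subrK.
  by rewrite scale_scalar_mx; congr (_%:M); ring.
rewrite -mulr2n -scaler_nat => /(congr1 (fun M => 2^-1 *: M)).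
by rewrite scalerA scale_scalar_mx mulrA mulVf ?pnatr_eq0// scale1r mul1r.
Qed.

Lemma dot_FKM_Q x : dot (FKM_Q x *m x) x = FKM_sqsum x.
Proof.
rewrite mul_FKM_Q_mx dot_suml; apply: eq_bigr => i _.
by rewrite dotZl expr2.
Qed.

Lemma dot_FKM_Q2 x : dot (FKM_Q x *m x) (FKM_Q x *m x) = FKM_sqsum x * dot x x.
Proof. by rewrite dot_mull FKM_Q_tr mulmxA FKM_Q_sq mul_scalar_mx dotZr. Qed.

(** Moving Q to the other side and anticommuting it past [P i] returns the same quantity with the
    opposite sign, plus [2 * dot (P i *m x) x * dot x x]; the equation is then solved. *)
Lemma dot_P_FKM_Q x i :
  dot (P i *m x) (FKM_Q x *m x) = dot (P i *m x) x * dot x x.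
Proof.
have E : dot (P i *m x) (FKM_Q x *m x) = dot (P i *m (FKM_Q x *m x)) x.
  by rewrite [RHS]dot_mull cliff_tr dotC.
have E' : dot (P i *m x) (FKM_Q x *m x) = dot (FKM_Q x *m (P i *m x)) x.
  by rewrite [RHS]dot_mull FKM_Q_tr.
move: E'; rewrite mulmxA FKM_Q_anticomm mulmxBl mul_scalar_mx -mulmxA.
by rewrite !dot_lin -E => E'; lra.
Qed.

(** With p = <P_i x, x> and q = [FKM_sqsum x], anticommutation gives Q P_i Q = 2 p Q - q P_i, whose
    form at [x] is 2 p q - q p. *)
Lemma dot_P_FKM_QQ x i :
  dot (P i *m (FKM_Q x *m x)) (FKM_Q x *m x) = dot (P i *m x) x * FKM_sqsum x.
Proof.
rewrite dotC dot_mull FKM_Q_tr !mulmxA FKM_Q_anticomm mulmxBl mulmxBl.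
rewrite -(mulmxA (P i)) FKM_Q_sq mul_scalar_mx -scalemxAl mul_mx_scalar.
rewrite -scalemxAl !dot_lin [dot x (FKM_Q x *m x)]dotC dot_FKM_Q.
by rewrite [dot x (P i *m x)]dotC; ring.
Qed.

Lemma dot_FKM_comb al be x (d := al *: x + be *: (FKM_Q x *m x)) :
  dot d d = al ^+ 2 * dot x x + 2 * al * be * FKM_sqsum x
            + be ^+ 2 * FKM_sqsum x * dot x x.
Proof.
rewrite /d !dot_lin [dot x (_ *m x)]dotC dot_FKM_Q dot_FKM_Q2; ring.
Qed.

(** Every <P_i d, d> is <P_i x, x> times one factor that does not depend on [i], so the factor
    leaves the sum. *)
Lemma FKM_sqsum_comb al be x (d := al *: x + be *: (FKM_Q x *m x)) :
  FKM_sqsum d = FKM_sqsum x *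
    (al ^+ 2 + 2 * al * be * dot x x + be ^+ 2 * FKM_sqsum x) ^+ 2.
Proof.
rewrite {1 2}/FKM_sqsum mulr_suml; apply: eq_bigr => i _.
rewrite -exprMn; congr (_ ^+ 2).
rewrite /d mulmxDr -!scalemxAr !dot_lin dot_P_FKM_QQ dot_P_FKM_Q.
have -> : dot (P i *m (FKM_Q x *m x)) x = dot (P i *m x) x * dot x x.
  by rewrite dot_mull cliff_tr dotC dot_P_FKM_Q.
ring.
Qed.

Lemma FKM_polynomialZ c x :
  FKM_polynomial P (c *: x) = c ^+ 4 * FKM_polynomial P x.
Proof.
rewrite /FKM_polynomial !dot_lin.
under eq_bigr do rewrite -scalemxAr !dot_lin mulrA exprMn.
by rewrite -mulr_sumr; ring.
Qed.

(** The right-hand side is dF_x(v) as the product rule delivers it. The gradient is 4 |x|^2 x - 8 Q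
    x, which becomes 4 xi on the unit sphere. *)
Lemma dot_FKM_xi x v : dot x x = 1 ->
  4 * dot (FKM_xi P x) v = 4 * dot x x * dot x v
     - 8 * \sum_i dot (P i *m x) x * dot (P i *m x) v.
Proof.
move=> x1; rewrite /FKM_xi !dot_lin x1 dot_suml.
under eq_bigr do rewrite dotZl.
ring.
Qed.

(** Stated along a map [f], it serves for lines, for curves in M_0 and for the identity map. *)
Lemma is_derive_FKM (V : normedModType R) (f : V -> 'cV[R]_n) (x v : V)
    (df : 'cV[R]_n) :
  is_derive x v f df -> dot (f x) (f x) = 1 ->
  is_derive x v (fun y : V => FKM_polynomial P (f y) : R^o)
    (4 * dot (FKM_xi P (f x)) df).
Proof.
move=> Df f1; rewrite dot_FKM_xi//.
have D1 := is_deriveX 2 (is_derive_dot Df Df).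
have D2 i := is_deriveX 2 (is_derive_dot (is_derive_mulmx (P i) Df) Df).
have := is_deriveB D1 (is_deriveZ 2 (is_derive_sum D2)).
set g := (X in is_derive x v X _) => Dg.
have -> : (fun y : V => FKM_polynomial P (f y)) = g.
  by apply/funext => y; rewrite /g !fctE fct_sumE.
apply: (is_derive_eq Dg) => /=.
rewrite -![_ *: _]/(_ * _) !mulr_sumr; congr (_ - _).
  by rewrite [dot df (f x)]dotC; ring.
apply: eq_bigr => i _; rewrite -![_ *: _]/(_ * _).
rewrite [dot (P i *m df) (f x)]dot_mull cliff_tr [dot df _]dotC; ring.
Qed.

End Clifford.

(** * The tangent spaces of M_0 *)

Section TangentSpace.
Variables (R : realType) (n m : nat) (P : 'I_m.+1 -> 'M[R]_n).
Hypothesis hP : symmetric_clifford_system P.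
Implicit Types (x y v : 'cV[R]_n).

Section SmoothComposition.
Variables (V : normedModType R) (k : nat) (U : set V) (f : V -> 'cV[R]_n).
Hypotheses (oU : open U) (Cf : Ck_on k U f).

Lemma Ck_on_P_form i : Ck_on k U (fun z => dot (P i *m f z) (f z) : R^o).
Proof. by apply: Ck_on_dot => //; exact: Ck_on_mulmx. Qed.

Lemma Ck_on_FKM_sqsum : Ck_on k U (fun z => FKM_sqsum P (f z) : R^o).
Proof.
apply: (@Ck_on_sum R V R^o) => // i.
by under eq_fun do rewrite expr2; apply: Ck_onM => //; exact: Ck_on_P_form.
Qed.

Lemma Ck_on_FKM_Q : Ck_on k U (fun z => FKM_Q P (f z) *m f z).
Proof.
under eq_fun do rewrite mul_FKM_Q_mx.
apply: Ck_on_sum => // i; apply: Ck_on_scale => //; first exact: Ck_on_P_form.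
exact: Ck_on_mulmx.
Qed.

Lemma Ck_on_FKM_xi : Ck_on k U (fun z => FKM_xi P (f z)).
Proof.
under eq_fun do rewrite FKM_xiE -scaleNr.
apply: Ck_onD => //; apply: (Ck_on_scale (a := fun=> - 2)) => //.
  exact: Ck_on_cst.
exact: Ck_on_FKM_Q.
Qed.

Lemma Ck_on_FKM : Ck_on k U (fun z => FKM_polynomial P (f z) : R^o).
Proof.
have -> : (fun z => FKM_polynomial P (f z)) = (fun z =>
    dot (f z) (f z) * dot (f z) (f z) + (- 2) * FKM_sqsum P (f z)).
  by apply/funext => z; rewrite FKM_polynomialE; ring.
apply: Ck_onD => //; apply: Ck_onM => //.
- exact: Ck_on_dot.
- exact: Ck_on_dot.
- exact: Ck_on_cst.
- exact: Ck_on_FKM_sqsum.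
Qed.

End SmoothComposition.

Lemma FKM_M0P x : FKM_M0 P x <-> FKM_polynomial P x = 0 /\ dot x x = 1.
Proof. by []. Qed.

Lemma FKM_sqsum_M0 x : FKM_M0 P x -> FKM_sqsum P x = 2^-1.
Proof.
by move=> [F0 x1]; move: F0; rewrite /= FKM_polynomialE x1 => F0; lra.
Qed.

Lemma dot_M0 x : FKM_M0 P x -> dot x x = 1. Proof. by case. Qed.

Lemma dot_FKM_xi_l x : FKM_M0 P x -> dot (FKM_xi P x) x = 0.
Proof.
move=> Mx; rewrite FKM_xiE !dot_lin dot_M0// dot_FKM_Q FKM_sqsum_M0//.
by rewrite mulfV ?pnatr_eq0// subrr.
Qed.

Lemma dot_FKM_xi_xi x : FKM_M0 P x -> dot (FKM_xi P x) (FKM_xi P x) = 1.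
Proof.
move=> Mx; rewrite FKM_xiE !dot_lin dot_M0// [dot x (_ *m _)]dotC dot_FKM_Q.
by rewrite dot_FKM_Q2// FKM_sqsum_M0// dot_M0//; field.
Qed.

(* [r] and [s] are chosen so that the quadratic form in [al, be] expressing
   [F (al *: y + be *: (Q *m y)) = 0] vanishes; at [y] in M_0 one has
   [r = s = 1], [al = 2] and [be = 0]. *)
Lemma FKM_zero_comb y (r s : R) (N := dot y y) (q := FKM_sqsum P y)
    (d := (r * (2 * N - r + s)) *: y + (2 * (N - r)) *: (FKM_Q P y *m y)) :
  r ^+ 2 = 2 * q -> s ^+ 2 = 2 * N ^+ 2 - 2 * q -> 0 < r -> 0 <= s ->
  q < N ^+ 2 -> FKM_polynomial P d = 0 /\ 0 < dot d d.
Proof.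
move=> r2 s2 r0 s0 qN.
have N0 : 0 < N.
  rewrite lt_def dot_ge0 andbT; apply/eqP => N0.
  by move: qN; rewrite N0 expr0n /=; nra.
have q0 : 0 < q by nra.
have qE : q = r ^+ 2 / 2 by rewrite r2; field.
rewrite /d; set al := r * _; set be := 2 * _.
(* Here r^2 = 2 q < 2 N^2 forces r < 2 N. *)
have al0 : 0 < al by rewrite mulr_gt0//; nra.
split.
  rewrite FKM_polynomialE (dot_FKM_comb hP) (FKM_sqsum_comb hP) -/N -/q.
  (* F(d) = 0 reads |d|^4 = 2 q B^2 = (r B)^2 with B the factor of [FKM_sqsum_comb], so |d|^2 = r B
     suffices; the two sides differ by a multiple of the relation defining [s]. *)
  have -> : al ^+ 2 * N + 2 * al * be * q + be ^+ 2 * q * N =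
      r * (al ^+ 2 + 2 * al * be * N + be ^+ 2 * q).
    have -> : al ^+ 2 * N + 2 * al * be * q + be ^+ 2 * q * N =
       r * (al ^+ 2 + 2 * al * be * N + be ^+ 2 * q)
       + r ^+ 2 * (N - r) * (s ^+ 2 - (2 * N ^+ 2 - 2 * q)).
      by rewrite qE /al /be; field.
    by rewrite s2 subrr mulr0 addr0.
  by rewrite exprMn r2; ring.
(* Completing the square in N |d|^2; the remainder is nonnegative because 0 < q < N^2. *)
rewrite (dot_FKM_comb hP) -/N -/q -(pmulr_rgt0 _ N0).
have -> : N * (al ^+ 2 * N + 2 * al * be * q + be ^+ 2 * q * N) =
  (N * al + be * q) ^+ 2 + be ^+ 2 * (q * (N ^+ 2 - q)) by ring.
have qN0 : 0 < q * (N ^+ 2 - q) by rewrite mulr_gt0 ?subr_gt0.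
have [->|be0] := eqVneq be 0.
  by rewrite mul0r addr0 expr0n mul0r addr0 exprn_gt0// mulr_gt0.
by rewrite ltr_wpDl ?sqr_ge0// mulr_gt0// exprn_even_gt0.
Qed.

Lemma rsqrtE (a : R) : 0 < a -> a * (Num.sqrt a)^-1 = Num.sqrt a.
Proof.
move=> a0; rewrite -{1}(sqr_sqrtr (ltW a0)) expr2 mulfK//.
by rewrite gt_eqF// sqrtr_gt0.
Qed.

(** Together with [is_derive0D]: functions stationary at a point are closed under products and sums.
    All scalar coefficients of the curve below are stationary at 0. *)
Lemma is_derive0M (f g : R^o -> R^o) (t : R^o) :
  is_derive t 1 f 0 -> is_derive t 1 g 0 ->
  is_derive t 1 (fun z => f z * g z : R^o) 0.
Proof.
move=> Df Dg; apply: (is_derive_eq (is_deriveM Df Dg)).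
by rewrite !scaler0 addr0.
Qed.

Lemma is_derive0D (f g : R^o -> R^o) (t : R^o) :
  is_derive t 1 f 0 -> is_derive t 1 g 0 ->
  is_derive t 1 (fun z => f z + g z : R^o) 0.
Proof. by move=> Df Dg; rewrite -(addr0 0); exact: is_deriveD. Qed.

Lemma Ck_on_is_derive (W : normedModType R) k (U : set R^o) (f : R^o -> W) t :
  U t -> Ck_on k.+1 U f -> is_derive t 1 f ('D_1 f t).
Proof. by move=> Ut [/(_ t Ut) df _]; apply/derivableP/diff_derivable. Qed.

(** N is stationary at 0 because <x, v> = 0, and F along the line because <xi, v> = 0; hence so are
    q and every coefficient built from N and q. Only the line itself then contributes to the
    velocity. *)
Lemma FKM_curve x v : FKM_M0 P x -> dot x v = 0 -> dot (FKM_xi P x) v = 0 ->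
  tangent_space (FKM_M0 P) x v.
Proof.
move=> Mx xv xiv.
pose y (t : R^o) := x + t *: v.
pose N (t : R^o) : R^o := dot (y t) (y t).
pose q (t : R^o) : R^o := FKM_sqsum P (y t).
pose s2 (t : R^o) : R^o := 2 * (N t * N t) + (- 2) * q t.
(* [r] and [s] are the square roots of [2 * q] and [s2], spelled through [(Num.sqrt _)^-1] so that
   [Ck_on_rsqrt] applies; [- 1 *] stands for subtraction so that sums and products suffice. *)
pose r (t : R^o) : R^o := (2 * q t) * (Num.sqrt (2 * q t))^-1.
pose s (t : R^o) : R^o := s2 t * (Num.sqrt (s2 t))^-1.
pose al (t : R^o) : R^o := r t * (2 * N t + - 1 * r t + s t).
pose be (t : R^o) : R^o := 2 * (N t + - 1 * r t).
pose d (t : R^o) := al t *: y t + be t *: (FKM_Q P (y t) *m y t).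
pose c (t : R^o) := (Num.sqrt (dot (d t) (d t)))^-1 *: d t.
(* Both radicands are positive on [I], so the roots are smooth there; positivity of [s2] is also the
   condition q < N^2 of [FKM_zero_comb]. *)
pose I : set R^o := [set t | 0 < q t] `&` [set t | 0 < s2 t].
have Cy U k : open U -> Ck_on k U y.
  move=> oU; apply: Ck_onD => //; first exact: Ck_on_cst.
  apply: (Ck_on_scale (a := id)) => //; last exact: Ck_on_cst.
  exact: Ck_on_id.
have CN U k : open U -> Ck_on k U N.
  by move=> oU; apply: Ck_on_dot => //; exact: Cy.
have Cq U k : open U -> Ck_on k U q.
  by move=> oU; apply: Ck_on_FKM_sqsum => //; exact: Cy.
have Ccst U k (a : R^o) : Ck_on k U (fun _ : R^o => a) by exact: Ck_on_cst.
have Cs2 U k : open U -> Ck_on k U s2.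
  move=> oU; apply: Ck_onD => //; apply: Ck_onM => //; last exact: Cq.
  by apply: Ck_onM => //; exact: CN.
have oI : open I.
  have pos_open (f : R^o -> R^o) : Ck_on 0 setT f -> open [set t | 0 < f t].
    move=> Cf; apply: (@open_comp _ _ f [set z | 0 < z]) => [z _|].
      exact: Cf.
    exact: open_gt.
  by apply: openI; apply: pos_open; [exact: Cq openT|exact: Cs2 openT].
have y0 : y 0 = x by rewrite /y scale0r addr0.
have x1 := dot_M0 Mx.
have N0 : N 0 = 1 by rewrite /N y0.
have q0 : q 0 = 2^-1 by rewrite /q y0 FKM_sqsum_M0.
have q20 : 2 * q 0 = 1 by rewrite q0 mulfV// pnatr_eq0.
have s20 : s2 0 = 1 by rewrite /s2 N0 q0; field.
have r0 : r 0 = 1 by rewrite /r q20 sqrtr1 invr1 mulr1.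
have s0 : s 0 = 1 by rewrite /s s20 sqrtr1 invr1 mulr1.
have al0 : al 0 = 2 by rewrite /al N0 r0 s0; ring.
have be0 : be 0 = 0 by rewrite /be N0 r0; ring.
have d0 : d 0 = 2 *: x by rewrite /d al0 be0 y0 scale0r addr0.
have rs0 : (Num.sqrt (dot (d 0) (d 0)))^-1 = 2^-1 :> R.
  rewrite d0 !dot_lin x1 (_ : 2 * _ = 2 ^+ 2); last by ring.
  by rewrite sqrtr_sqr gtr0_norm.
have I0 : I 0 by split; rewrite /= ?q0 ?s20// invr_gt0.
have Cd k : Ck_on k I d.
  have Cr : Ck_on k I r.
    apply: Ck_onM => //; first by apply: Ck_onM => //; exact: Cq.
    apply: Ck_on_rsqrt => //; last by apply: Ck_onM => //; exact: Cq.
    by move=> t [qt _]; rewrite mulr_gt0.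
  have Cs : Ck_on k I s.
    apply: Ck_onM => //; first exact: Cs2.
    by apply: Ck_on_rsqrt => //; [move=> t []|exact: Cs2].
  have Cal : Ck_on k I al.
    apply: Ck_onM => //; apply: Ck_onD => //; apply: Ck_onD => //.
      by apply: Ck_onM => //; exact: CN.
    exact: Ck_onM.
  have Cbe : Ck_on k I be.
    apply: Ck_onM => //; apply: Ck_onD => //; first exact: CN.
    exact: Ck_onM.
  apply: Ck_onD => //; apply: Ck_on_scale => //; first exact: Cy.
  by apply: Ck_on_FKM_Q => //; exact: Cy.
have dP t : I t -> FKM_polynomial P (d t) = 0 /\ 0 < dot (d t) (d t).
  move=> [/= qt s2t]; have q2t : 0 < 2 * q t by rewrite mulr_gt0.
  have rE : r t = Num.sqrt (2 * q t) by exact: rsqrtE.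
  have sE : s t = Num.sqrt (s2 t) by exact: rsqrtE.
  have -> : d t = (r t * (2 * N t - r t + s t)) *: y t +
      (2 * (N t - r t)) *: (FKM_Q P (y t) *m y t) by rewrite /d /al /be !mulN1r.
  apply: FKM_zero_comb.
  - by rewrite rE sqr_sqrtr// ltW.
  - by rewrite sE sqr_sqrtr ?ltW// /s2 /N /q; ring.
  - by rewrite rE sqrtr_gt0.
  - by rewrite sE sqrtr_ge0.
  - by move: s2t; rewrite /s2 /N /q; lra.
have Dc (a : R) : is_derive (0 : R^o) 1 (fun _ : R^o => a : R^o) 0.
  exact: is_derive_cst.
have Dy : is_derive (0 : R^o) 1 y v.
  have := is_deriveD (is_derive_cst x (0 : R^o) 1)
    (is_derive_scale (is_derive_id (0 : R^o) 1) (is_derive_cst v (0 : R^o) 1)).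
  by move=> D; apply: (is_derive_eq D); rewrite scaler0 add0r add0r scale1r.
have DN : is_derive (0 : R^o) 1 N 0.
  apply: (is_derive_eq (is_derive_dot Dy Dy)).
  by rewrite y0 [dot v x]dotC xv addr0.
(* q = (N^2 - F) / 2, and both N and F are stationary along the line. *)
have Dq : is_derive (0 : R^o) 1 q 0.
  have DF : is_derive (0 : R^o) 1 (fun t => FKM_polynomial P (y t) : R^o) 0.
    by apply: (is_derive_eq (is_derive_FKM hP Dy _)); rewrite y0// xiv mulr0.
  have := is_derive0D (is_derive0M (Dc 2^-1) (is_derive0M DN DN))
    (is_derive0M (Dc (- 2^-1)) DF).
  congr (is_derive _ _ _ _); apply/funext => t.
  by rewrite FKM_polynomialE -/(N t) -/(q t); field.
have D_rsqrt (f : R^o -> R^o) : 0 < f 0 -> is_derive (0 : R^o) 1 f 0 ->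
    is_derive (0 : R^o) 1 (fun t => (Num.sqrt (f t))^-1 : R^o) 0.
  by move=> f0 Df; apply: (is_derive_eq (is_derive_rsqrt f0 Df)); rewrite mulr0.
have Ds2 : is_derive (0 : R^o) 1 s2 0.
  by apply: is_derive0D; apply: is_derive0M => //; exact: is_derive0M.
have Dr : is_derive (0 : R^o) 1 r 0.
  apply: is_derive0M; first exact: is_derive0M.
  by apply: D_rsqrt; [rewrite q20|exact: is_derive0M].
have Ds : is_derive (0 : R^o) 1 s 0.
  by apply: is_derive0M => //; apply: D_rsqrt => //; rewrite s20.
have Dal : is_derive (0 : R^o) 1 al 0.
  apply: is_derive0M => //; apply: is_derive0D => //.
  by apply: is_derive0D => //; exact: is_derive0M.
have Dbe : is_derive (0 : R^o) 1 be 0.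
  apply: is_derive0M => //; apply: is_derive0D => //; exact: is_derive0M.
(* As [be] and its derivative vanish at 0, the Q-term adds nothing to the velocity, so mere
   existence of its derivative [DQ] is enough. *)
have Dd : is_derive (0 : R^o) 1 d (2 *: v).
  have DQ := Ck_on_is_derive I0 (Ck_on_FKM_Q oI (Cy I 1%N oI)).
  apply: (is_derive_eq
    (is_deriveD (is_derive_scale Dal Dy) (is_derive_scale Dbe DQ))).
  by rewrite al0 be0 !scale0r !addr0.
(* |d|^2 is stationary, so normalizing just multiplies the velocity [2 *: v] by 1/|d(0)| = 1/2. *)
have Dc' : is_derive (0 : R^o) 1 c v.
  have Ddd : is_derive (0 : R^o) 1 (fun t => dot (d t) (d t) : R^o) 0.
    apply: (is_derive_eq (is_derive_dot Dd Dd)).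
    by rewrite d0 !dot_lin [dot v x]dotC xv !mulr0 addr0.
  have dd0 := (dP 0 I0).2.
  apply: (is_derive_eq (is_derive_scale (D_rsqrt _ dd0 Ddd) Dd)).
  rewrite scale0r addr0 rs0.
  by rewrite scalerA mulVf ?scale1r// pnatr_eq0.
exists I, c; split; split=> //.
- move=> k; apply: Ck_on_scale => //; apply: Ck_on_rsqrt => //.
    by move=> t /dP[].
  exact: Ck_on_dot.
- move=> t It; have [F0 dd0] := dP t It; apply/FKM_M0P; split.
    by rewrite FKM_polynomialZ F0 mulr0.
  rewrite /c dotZl dotZr mulrA -invfM -expr2 sqr_sqrtr ?ltW// mulVf//.
  by rewrite gt_eqF.
- by rewrite /c rs0 d0 scalerA mulVf ?scale1r// pnatr_eq0.
- by case: Dc'.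
Qed.

(** For a curve in M_0, |c|^2 and F(c) are constant; their derivatives at 0 are 2 <x, v> and 4 <xi,
    v>. The converse is [FKM_curve]. *)
Lemma tangent_spaceP x v : FKM_M0 P x ->
  tangent_space (FKM_M0 P) x v <-> dot x v = 0 /\ dot (FKM_xi P x) v = 0.
Proof.
move=> Mx; split; last by case; exact: FKM_curve.
move=> [I [c [[oI I0 sc] [Mc c0 Dc]]]].
have {}Dc : is_derive (0 : R^o) 1 c v.
  by rewrite -Dc; exact: Ck_on_is_derive I0 (sc 1%N).
have D0 (f : R^o -> R^o) (a b : R) :
    is_derive (0 : R^o) 1 f b -> (forall t, I t -> f t = a) -> b = 0.
  move=> Df fa; have : is_derive (0 : R^o) 1 (fun _ : R^o => a : R^o) b.
    apply: near_eq_is_derive Df.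
    by apply: filterS (open_nbhs_nbhs (conj oI I0)).
  by case=> _ <-; rewrite derive_cst.
have := D0 _ 1 _ (is_derive_dot Dc Dc).
rewrite c0 [dot v x]dotC => /(_ (fun t It => dot_M0 (Mc t It))) xv.
have c01 : dot (c 0) (c 0) = 1 by rewrite c0 dot_M0.
have := D0 _ 0 _ (is_derive_FKM hP Dc c01) (fun t It => (Mc t It).1).
by rewrite c0 => xiv; split; lra.
Qed.

(** The local equations are F = 0 and |y|^2 = 1. Their differential v -> (4 <xi, v>, 2 <y, v>) is
    onto because y and xi(y) are orthonormal. Codimension 2 in the ambient space means a
    hypersurface of the sphere. *)
Lemma FKM_M0_submanifold : embedded_submanifold 2 (FKM_M0 P).
Proof.
move=> x Mx.
pose g (y : 'cV[R]_n) : 'cV[R]_2 := FKM_polynomial P y *: delta_mx 0 0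
  + (dot y y + - 1) *: delta_mx 1 0.
have g0 y : g y 0 0 = FKM_polynomial P y.
  by rewrite !mxE /= mulr1 mulr0 addr0.
have g1 y : g y 1 0 = dot y y - 1.
  by rewrite !mxE /= mulr1 mulr0 add0r.
have sg : smooth_on setT g.
  have oT := @openT 'cV[R]_n; have Ci k := @Ck_on_id R 'cV[R]_n k setT.
  move=> k; apply: Ck_onD => //; apply: (@Ck_on_scale R 'cV[R]_n 2) => //.
  - exact: Ck_on_FKM.
  - exact: Ck_on_cst.
  - apply: Ck_onD => //; [exact: Ck_on_dot|exact: Ck_on_cst].
  - exact: Ck_on_cst.
exists setT, g; split=> //; first exact: openT.
  move=> y _; split=> [[F0 y1]|gy0].
    apply/colP => i; rewrite [RHS]mxE.
    case: (unliftP 0 i) => [j|] ->; last by rewrite g0.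
    by rewrite (_ : lift 0 j = 1) ?g1 ?y1 ?subrr//; apply/val_inj; rewrite ord1.
  apply/FKM_M0P; split; first by rewrite -g0 gy0 mxE.
  by apply/eqP; rewrite -subr_eq0 -g1 gy0 mxE.
move=> y _ My w.
have Dg := (sg 1%N).1 y I.
(* The coefficients solve 4 <xi, v> = w_0 and 2 <y, v> = w_1. *)
pose v := (w 0 0 / 4) *: FKM_xi P y + (w 1 0 / 2) *: y.
exists v; rewrite -deriveE//.
have {}Dg : is_derive y v g ('D_v g y).
  by apply: derivableP; exact: diff_derivable.
have Di := is_derive_id y v.
have yv : dot y v = w 1 0 / 2.
  rewrite dotDr !dotZr [dot y (FKM_xi P y)]dotC dot_FKM_xi_l// dot_M0//.
  by rewrite mulr0 add0r mulr1.
have xiv : dot (FKM_xi P y) v = w 0 0 / 4.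
  by rewrite dotDr !dotZr dot_FKM_xi_l// dot_FKM_xi_xi// mulr0 addr0 mulr1.
apply/colP => i; case: (unliftP 0 i) => [j|] ->.
  have -> : lift 0 j = 1 by apply/val_inj; rewrite ord1.
  have := is_derive_coord 1 Dg.
  under eq_fun do rewrite g1.
  case=> _ <-.
  have D1 := is_derive_cst (1 : R^o) y v.
  have D := is_deriveB (is_derive_dot Di Di) D1.
  have [_ ->] := D.
  by rewrite [dot v _]dotC yv subr0; field.
have := is_derive_coord 0 Dg.
under eq_fun do rewrite g0.
case=> _ <-; have [_ ->] := is_derive_FKM hP Di (dot_M0 My).
by rewrite xiv; field.
Qed.

End TangentSpace.

(** * The almost complex structure *)

Section AlmostHermitian.
Variables (R : realType) (n m : nat) (P : 'I_m.+1 -> 'M[R]_n).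
Hypotheses (hm : (1 <= m)%N) (hP : symmetric_clifford_system P).
Implicit Types (x y u v w : 'cV[R]_n).

Local Notation A := (P0P1 P).
Local Notation xi := (FKM_xi P).
Local Notation M0 := (FKM_M0 P).
Local Notation eta1 := (FKM_eta1 P).
Local Notation eta2 := (FKM_eta2 P).

Let i1 : 'I_m.+1 := inord 1.

Lemma ord0_neq_inord1 : ord0 != i1.
Proof. by apply/eqP => /(congr1 val); rewrite /= inordK. Qed.

Lemma P0P1_anti : A = - (P i1 *m P ord0).
Proof. exact: cliffC ord0_neq_inord1. Qed.

Lemma P0P1_tr : A^T = - A.
Proof. by rewrite {1}/P0P1 trmx_mul !(cliff_tr hP) P0P1_anti opprK. Qed.

Lemma P0P1_sq : A *m A = - 1%:M.
Proof.
rewrite {1}P0P1_anti mulNmx /P0P1 mulmxA -(mulmxA (P i1)) (cliff_sq hP) mulmx1.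
by rewrite cliff_sq.
Qed.

Lemma P0P1K u : A *m (A *m u) = - u.
Proof. by rewrite mulmxA P0P1_sq mulNmx mul1mx. Qed.

Lemma dot_P0P1l u v : dot (A *m u) v = - dot (A *m v) u.
Proof. by rewrite dot_mull P0P1_tr mulNmx dotNr dotC. Qed.

Lemma dot_P0P1 u v : dot (A *m u) (A *m v) = dot u v.
Proof. by rewrite dot_P0P1l P0P1K dotNl opprK dotC. Qed.

Lemma dot_P0P1_id u : dot (A *m u) u = 0.
Proof. by have := dot_P0P1l u u; lra. Qed.

(** [P i] anticommutes with both factors of [A], hence commutes with [A]; a symmetric matrix times a
    skew one commuting with it is skew. *)
Lemma dot_P0P1_P x i : i != ord0 -> i != i1 -> dot (A *m x) (P i *m x) = 0.
Proof.
move=> i0 i1'.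
have AP : A *m P i = P i *m A.
  rewrite /P0P1 mulmxA -mulmxA -/i1 [P i1 *m _]cliffC 1?eq_sym//.
  by rewrite mulmxN mulmxA [P ord0 *m _]cliffC 1?eq_sym// mulNmx opprK.
suff : dot (A *m x) (P i *m x) = - dot (A *m x) (P i *m x) by lra.
rewrite {1}dot_P0P1l mulmxA AP -mulmxA; congr (- _).
by rewrite dot_mull cliff_tr.
Qed.

(** In the sum over [i], the terms of index 0 and 1 are <P_0 x, x> <P_1 x, x> and its opposite; the
    others vanish by [dot_P0P1_P]. *)
Lemma dot_P0P1_xi x : dot (A *m x) (xi x) = 0.
Proof.
rewrite FKM_xiE !dot_lin dot_P0P1_id mul_FKM_Q_mx dotC dot_suml.
under eq_bigr do rewrite dotZl [X in _ * X]dotC.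
rewrite (bigD1 ord0)//= (bigD1 i1) 1?eq_sym ?ord0_neq_inord1//=.
rewrite big1 => [|i /andP[i0 ii1]]; last by rewrite dot_P0P1_P ?mulr0.
have -> : dot (A *m x) (P ord0 *m x) = dot (P i1 *m x) x.
  by rewrite /P0P1 -mulmxA [LHS]dot_mull (cliff_tr hP) (cliffK hP ord0 x).
have -> : dot (A *m x) (P i1 *m x) = - dot (P ord0 *m x) x.
  rewrite P0P1_anti mulNmx dotNl -mulmxA dotC dot_mull (cliff_tr hP).
  by rewrite (cliffK hP i1) dotC.
ring.
Qed.

(** * The orthonormal frame x, xi, eta1, eta2 at a point of M_0 *)

Section AtPoint.
Variable x : 'cV[R]_n.
Hypothesis Mx : M0 x.

Let xx : dot x x = 1 := dot_M0 Mx.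
Let zz : dot (xi x) (xi x) = 1 := dot_FKM_xi_xi hP Mx.
Let zx : dot (xi x) x = 0 := dot_FKM_xi_l Mx.
Let xz : dot x (xi x) = 0. Proof. by rewrite dotC zx. Qed.
Let Axz : dot (A *m x) (xi x) = 0 := dot_P0P1_xi x.
Let Azx : dot (A *m xi x) x = 0. Proof. by rewrite dot_P0P1l Axz oppr0. Qed.
Let Ax_r u : dot u (A *m x) = dot (A *m x) u. Proof. exact: dotC. Qed.
Let Az_r u : dot u (A *m xi x) = dot (A *m xi x) u. Proof. exact: dotC. Qed.

Lemma eta1_tangent : tangent_space M0 x (eta1 x).
Proof. by apply/tangent_spaceP => //; rewrite /FKM_eta1 !Ax_r dot_P0P1_id. Qed.

Lemma eta2_tangent : tangent_space M0 x (eta2 x).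
Proof. by apply/tangent_spaceP => //; rewrite /FKM_eta2 !Az_r dot_P0P1_id. Qed.

Lemma eta1_eta1 : dot (eta1 x) (eta1 x) = 1. Proof. by rewrite dot_P0P1. Qed.
Lemma eta2_eta2 : dot (eta2 x) (eta2 x) = 1. Proof. by rewrite dot_P0P1. Qed.
Lemma eta1_eta2 : dot (eta1 x) (eta2 x) = 0. Proof. by rewrite dot_P0P1. Qed.

Lemma eta_free : free [:: eta1 x; eta2 x].
Proof.
have nz u : dot u u = 1 -> u != 0.
  by move=> u1; apply/eqP => u0; move: u1; rewrite u0 dot0l; lra.
rewrite free_cons free_cons nil_free span_nil memv0 andbT.
rewrite nz ?eta2_eta2// andbT span_seq1; apply/negP => /vlineP[k e].
have : dot (eta1 x) (eta1 x) = 0 by rewrite {2}e dotZr eta1_eta2 mulr0.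
by rewrite eta1_eta1; lra.
Qed.

(** [A] permutes x, xi, eta1, eta2 up to sign, so its skewness preserves orthogonality to all
    four. *)
Lemma P0P1_E : [set A *m X | X in FKM_E P x] `<=` FKM_E P x.
Proof.
move=> _ [X [/(tangent_spaceP hP _ Mx)[xX zX] X1 X2] <-].
have X1' : dot (A *m x) X = 0 by rewrite dotC.
have X2' : dot (A *m xi x) X = 0 by rewrite dotC.
split; last 2 first.
- by rewrite dot_P0P1 dotC.
- by rewrite dot_P0P1 dotC.
apply/tangent_spaceP => //.
by rewrite dotC dot_P0P1l X1' [dot (xi x) _]dotC dot_P0P1l X2' oppr0.
Qed.

Lemma FKM_E_proj v : tangent_space M0 x v ->
  FKM_E P x (v - dot v (eta1 x) *: eta1 x - dot v (eta2 x) *: eta2 x).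
Proof.
move=> /(tangent_spaceP hP _ Mx)[xv zv].
have [x1 z1] := (tangent_spaceP hP _ Mx).1 eta1_tangent.
have [x2 z2] := (tangent_spaceP hP _ Mx).1 eta2_tangent.
split.
- apply/tangent_spaceP => //; rewrite !(dotDr, dotNr, dotZr) xv zv x1 x2 z1 z2.
  by lra.
- rewrite !(dotDl, dotNl, dotZl) eta1_eta1 [dot (eta2 x) _]dotC eta1_eta2.
  by lra.
- by rewrite !(dotDl, dotNl, dotZl) eta2_eta2 eta1_eta2; lra.
Qed.

End AtPoint.

Lemma tangent_space_linear x a u v : M0 x -> tangent_space M0 x u ->
  tangent_space M0 x v -> tangent_space M0 x (a *: u + v).
Proof.
move=> Mx /(tangent_spaceP hP _ Mx)[xu zu] /(tangent_spaceP hP _ Mx)[xv zv].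
by apply/tangent_spaceP => //; rewrite !(dotDr, dotZr) xu zu xv zv; lra.
Qed.

(** The specification fixes [J] on eta1, eta2 and E, which span the tangent space by [FKM_E_proj];
    linearity on tangent vectors does the rest. *)
Lemma FKM_J_spec_unique J J' : FKM_J_spec P J -> FKM_J_spec P J' ->
  forall x v, M0 x -> tangent_space M0 x v -> J' x v = J x v.
Proof.
move=> [lJ sJ] [lJ' sJ'] x v Mx Tv.
have Ew := FKM_E_proj Mx Tv.
set w := _ - _ - _ in Ew; have Tw : tangent_space M0 x w by case: Ew.
have T1 := eta1_tangent Mx; have T2 := eta2_tangent Mx.
have -> : v = dot v (eta1 x) *: eta1 x + (dot v (eta2 x) *: eta2 x + w).
  by rewrite /w [_ *: eta2 x + _]addrC subrK addrC subrK.
have T2w := tangent_space_linear (dot v (eta2 x)) Mx T2 Tw.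
have [_ l] := lJ x Mx; have [_ l'] := lJ' x Mx.
have [e1 e2 eE] := sJ x Mx; have [e1' e2' eE'] := sJ' x Mx.
by rewrite !l// !l'// e1 e2 (eE _ Ew) e1' e2' (eE' _ Ew).
Qed.

(* As [A *m eta1 x = - x] and [A *m eta2 x = - xi x], the correction terms
   replace [- x] by [eta2 x] and [- xi x] by [- eta1 x]. *)
Definition FKM_J x v : 'cV[R]_n :=
  A *m v + dot v (eta1 x) *: (x + eta2 x) + dot v (eta2 x) *: (xi x - eta1 x).

(** * Algebraic properties of [FKM_J] at a point of M_0 *)

Section JAtPoint.
Variable x : 'cV[R]_n.
Hypothesis Mx : M0 x.

Let xx : dot x x = 1 := dot_M0 Mx.
Let zz : dot (xi x) (xi x) = 1 := dot_FKM_xi_xi hP Mx.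
Let zx : dot (xi x) x = 0 := dot_FKM_xi_l Mx.
Let xz : dot x (xi x) = 0. Proof. by rewrite dotC zx. Qed.

Let e1x : dot (eta1 x) x = 0 := dot_P0P1_id x.
Let xe1 : dot x (eta1 x) = 0. Proof. by rewrite dotC. Qed.
Let e1z : dot (eta1 x) (xi x) = 0 := dot_P0P1_xi x.
Let ze1 : dot (xi x) (eta1 x) = 0. Proof. by rewrite dotC. Qed.
Let e2x : dot (eta2 x) x = 0.
Proof. by rewrite /FKM_eta2 dot_P0P1l e1z oppr0. Qed.
Let xe2 : dot x (eta2 x) = 0. Proof. by rewrite dotC. Qed.
Let e2z : dot (eta2 x) (xi x) = 0 := dot_P0P1_id _.
Let ze2 : dot (xi x) (eta2 x) = 0. Proof. by rewrite dotC. Qed.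
Let e12 := eta1_eta2 Mx.
Let e21 : dot (eta2 x) (eta1 x) = 0. Proof. by rewrite dotC. Qed.

(** The Gram matrix of the frame x, xi, eta1, eta2, as rewriting rules. *)
Let table := (xx, zz, zx, xz, e1x, xe1, e1z, ze1, e2x, xe2, e2z, ze2,
  e12, e21, eta1_eta1 Mx, eta2_eta2 Mx).

Let Av_x v : dot (A *m v) x = - dot v (eta1 x).
Proof. by rewrite dot_P0P1l dotC. Qed.
Let Av_z v : dot (A *m v) (xi x) = - dot v (eta2 x).
Proof. by rewrite dot_P0P1l dotC. Qed.
Let Av_e1 v : dot (A *m v) (eta1 x) = dot v x. Proof. exact: dot_P0P1. Qed.
Let Av_e2 v : dot (A *m v) (eta2 x) = dot v (xi x). Proof. exact: dot_P0P1. Qed.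

Let tableA := (Av_x, Av_z, Av_e1, Av_e2).

Lemma FKM_J_linear a u v : FKM_J x (a *: u + v) = a *: FKM_J x u + FKM_J x v.
Proof.
rewrite /FKM_J mulmxDr -scalemxAr !dotDl !dotZl.
by apply/colP => i; rewrite !mxE; ring.
Qed.

Lemma dot_FKM_J v w : dot (FKM_J x v) w = dot (A *m v) w
  + dot v (eta1 x) * (dot x w + dot (eta2 x) w)
  + dot v (eta2 x) * (dot (xi x) w - dot (eta1 x) w).
Proof. by rewrite /FKM_J 2!dotDl 2!dotZl 2!dotDl dotNl. Qed.

(** The x- and xi-components of the correction terms cancel those of [A *m v], which are -<v, eta1>
    and -<v, eta2>. *)
Lemma FKM_J_tangent v : tangent_space M0 x v -> tangent_space M0 x (FKM_J x v).
Proof.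
move=> /(tangent_spaceP hP _ Mx)[xv zv]; apply/tangent_spaceP => //.
rewrite dotC [dot (xi x) _]dotC !dot_FKM_J !tableA !table.
lra.
Qed.

Lemma dot_FKM_J_eta1 v : tangent_space M0 x v ->
  dot (FKM_J x v) (eta1 x) = - dot v (eta2 x).
Proof.
move=> /(tangent_spaceP hP _ Mx)[xv zv].
by rewrite dot_FKM_J !tableA !table dotC xv; lra.
Qed.

Lemma dot_FKM_J_eta2 v : tangent_space M0 x v ->
  dot (FKM_J x v) (eta2 x) = dot v (eta1 x).
Proof.
move=> /(tangent_spaceP hP _ Mx)[xv zv].
by rewrite dot_FKM_J !tableA !table dotC zv; lra.
Qed.

Lemma FKM_JK v : tangent_space M0 x v -> FKM_J x (FKM_J x v) = - v.
Proof.
move=> Tv; rewrite {1}/FKM_J dot_FKM_J_eta1// dot_FKM_J_eta2// /FKM_J.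
rewrite 2!mulmxDr -2!scalemxAr mulmxDr mulmxBr !P0P1K -/(eta1 x) -/(eta2 x).
(* Once [A] has been evaluated on the frame, the identity holds for arbitrary vectors and scalars,
   so it is checked coordinatewise. *)
move: (eta1 x) (eta2 x) (xi x) (dot v _) (dot v _) => e1 e2 z al be.
by apply/colP => i; rewrite !mxE; ring.
Qed.

(** Expanding J v against the tangent vector J u gives <A v, J u> plus the products of the
    eta-components of u and v; expanding J u against A v produces the same products with a minus
    sign. *)
Lemma FKM_J_isometry u v : tangent_space M0 x u -> tangent_space M0 x v ->
  dot (FKM_J x u) (FKM_J x v) = dot u v.
Proof.
move=> Tu Tv.
have [xv zv] := (tangent_spaceP hP _ Mx).1 Tv.
have [xJ zJ] := (tangent_spaceP hP _ Mx).1 (FKM_J_tangent Tu).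
have J1 := dot_FKM_J_eta1 Tu; have J2 := dot_FKM_J_eta2 Tu.
rewrite dotC dot_FKM_J xJ zJ [dot (eta1 x) _]dotC J1 [dot (eta2 x) _]dotC J2.
rewrite dotC dot_FKM_J dot_P0P1 ![dot _ (A *m v)]dotC !tableA.
rewrite [dot v x]dotC xv [dot v (xi x)]dotC zv; ring.
Qed.

Lemma FKM_J_eta1 : FKM_J x (eta1 x) = eta2 x.
Proof.
rewrite /FKM_J !table scale1r scale0r addr0 {1}/FKM_eta1 P0P1K.
by rewrite addrA addNr add0r.
Qed.

Lemma FKM_J_eta2 : FKM_J x (eta2 x) = - eta1 x.
Proof.
rewrite /FKM_J !table scale1r scale0r addr0 {1}/FKM_eta2 P0P1K.
by rewrite addrA addNr add0r.
Qed.

Lemma FKM_J_E X : FKM_E P x X -> FKM_J x X = A *m X.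
Proof. by case=> _ X1 X2; rewrite /FKM_J X1 X2 !scale0r !addr0. Qed.

End JAtPoint.

Lemma FKM_J_endo : tangent_endomorphism M0 FKM_J.
Proof.
move=> x Mx; split=> [u|a u v _ _]; first exact: FKM_J_tangent.
exact: FKM_J_linear.
Qed.

Lemma FKM_J_specP : FKM_J_spec P FKM_J.
Proof.
split=> [|x Mx]; first exact: FKM_J_endo.
by split=> [||X]; [exact: FKM_J_eta1|exact: FKM_J_eta2|exact: FKM_J_E].
Qed.

(** The formula for [FKM_J] is polynomial in the base point and the vector over the whole ambient
    space, so it is its own smooth extension. *)
Lemma FKM_J_smooth :
  smooth_on setT (fun p : 'cV[R]_n * 'cV[R]_n => FKM_J p.1 p.2).
Proof.
move=> k; set V := ('cV[R]_n * 'cV[R]_n)%type.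
have oT : open [set: V] := openT.
have C1 : Ck_on k setT (fun p : V => p.1) := Ck_on_fst k oT.
have C2 : Ck_on k setT (fun p : V => p.2) := Ck_on_snd k oT.
have Cxi : Ck_on k setT (fun p : V => xi p.1) by exact: Ck_on_FKM_xi.
have Ce1 : Ck_on k setT (fun p : V => eta1 p.1) by exact: Ck_on_mulmx.
have Ce2 : Ck_on k setT (fun p : V => eta2 p.1) by exact: Ck_on_mulmx.
apply: Ck_onD => //; first apply: Ck_onD => //.
- exact: Ck_on_mulmx.
- by apply: Ck_on_scale => //; [exact: Ck_on_dot|exact: Ck_onD].
- apply: Ck_on_scale => //; first exact: Ck_on_dot.
  under eq_fun do rewrite -scaleN1r; apply: Ck_onD => //.
  by apply: (Ck_on_scale (a := fun=> - 1)) => //; exact: Ck_on_cst.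
Qed.

Lemma FKM_J_almost_complex : almost_complex_structure M0 FKM_J.
Proof.
split; [exact: FKM_J_endo| |by move=> x u Mx; exact: FKM_JK].
move=> p _; exists setT, (fun p => FKM_J p.1 p.2).
by split=> //; [exact: openT|exact: FKM_J_smooth].
Qed.

End AlmostHermitian.

(** * The induced metric and the almost Hermitian structure *)

Lemma induced_metric_riemannian (R : realType) (n : nat) (M : set 'cV[R]_n) :
  riemannian_metric M (@induced_metric R n).
Proof.
split=> [x _|p _].
  split=> [u v _ _|a u v w _ _ _|u _]; rewrite /induced_metric.
  - exact: dotC.
  - by rewrite dotDl dotZl.
  - exact: dot_gt0.
exists setT, (fun p => induced_metric p.1.1 p.1.2 p.2 : R^o).
split=> //; first exact: openT.
move=> k; apply: Ck_on_dot; first exact: openT.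
  apply: (@Ck_on_comp_lin _ _ _ _ _ _ snd); first exact: openT.
    by move=> z; exact: cvg_snd.
  exact: (Ck_on_fst k openT).
exact: (Ck_on_snd k openT).
Qed.

Theorem proposition1 (R : realType) (l m : nat)
    (P : 'I_m.+1 -> 'M[R]_(2 * l))
    (hm : (1 <= m)%N) (hl : (1 <= l - m - 1)%N)
    (hP : symmetric_clifford_system P) :
  (forall x, FKM_M0 P x ->
     [/\ tangent_space (FKM_M0 P) x (FKM_eta1 P x),
         tangent_space (FKM_M0 P) x (FKM_eta2 P x),
         free [:: FKM_eta1 P x; FKM_eta2 P x] &
         [set P0P1 P *m X | X in FKM_E P x] `<=` FKM_E P x]) /\
  exists J : 'cV[R]_(2 * l) -> 'cV[R]_(2 * l) -> 'cV[R]_(2 * l),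
    [/\ FKM_J_spec P J,
        forall J', FKM_J_spec P J' ->
          forall x v, FKM_M0 P x -> tangent_space (FKM_M0 P) x v ->
            J' x v = J x v &
        almost_hermitian_manifold (FKM_M0 P) J (@induced_metric R (2 * l))].
Proof.
split=> [x Mx|].
  by split; [exact: eta1_tangent|exact: eta2_tangent|exact: eta_free
    |exact: P0P1_E].
exists (FKM_J P); split.
- exact: FKM_J_specP.
- by move=> J' sJ'; apply: FKM_J_spec_unique => //; exact: FKM_J_specP.
- split.
  + by exists 2%N; exact: FKM_M0_submanifold.
  + exact: FKM_J_almost_complex.
  + exact: induced_metric_riemannian.
  + by move=> x u v Mx Tu Tv; exact: FKM_J_isometry.
Qed.
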